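(* Let $G$ be a graph with $m\ge 1$ edges, let $M_2=4I+B$ where $B$ is the adjacency matrix of the line graph of $G$, let $f(\mathbf{w})=\mathbf{w}^\top M_2\mathbf{w}$, and let $R=\{\mathbf{w}\in\mathbb{R}^{E(G)}:\mathbf{1}^\top\mathbf{w}=m,\ \mathbf{w}\ge 0 \text{ entrywise}\}$. Let $(\mathbf{w}_n)_{n\ge 0}$ be any sequence generated by the following procedure: $\mathbf{w}_0=\mathbf{1}$; given $\mathbf{w}_n$, let $i$ be an index at which $M_2\mathbf{w}_n$ has its minimum entry; for each index $j\in E(G)$ set $$t_j=\frac{(M_2\mathbf{w}_n)_j-(M_2\mathbf{w}_n)_i}{8},\qquad \eta_j=\min\{t_j,(\mathbf{w}_n)_j\};$$ choose $j$ such that $\eta_j$ is maximized, and set $\mathbf{w}_{n+1}=\mathbf{w}_n+\eta_j(\mathbf{e}_i-\mathbf{e}_j)$. Then $(\mathbf{w}_n)$ converges to the minimizer of $f$ over $R$.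
   Context: Graphs are finite and simple. The line graph of $G$ has vertex set $E(G)$, two distinct edges being adjacent when they share a vertex. $\mathbf{1}$ is the all-ones vector and $\mathbf{e}_i$ the $i$-th standard basis vector of $\mathbb{R}^{E(G)}$. The matrix $M_2$ is positive definite, so $f$ has a unique minimizer on the compact convex set $R$. *)

(* Defs.v *)
From mathcomp Require Import all_boot all_order all_algebra.
From mathcomp Require Import all_classical all_reals all_analysis.

Set Implicit Arguments.
Unset Strict Implicit.
Unset Printing Implicit Defensive.

Import Order.TTheory GRing.Theory Num.Theory.
Import numFieldNormedType.Exports.

Local Open Scope ring_scope.

(* A finite simple graph is a symmetric irreflexive relation [e] on a finite
   type [V]; its edges are the pairs [[set x; y]] with [e x y]. *)
Definition edge_set (V : finType) (e : rel V) : {set {set V}} :=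
  [set A : {set V} | [exists x, exists y, e x y && (A == [set x; y]%SET)]].

(* E(G) is indexed by ['I_#|edge_set e|] through [enum_val], so that vectors
   and matrices over E(G) are MathComp matrices. *)
Definition line_graph (V : finType) (e : rel V) : rel 'I_#|edge_set e| :=
  fun i j => (i != j) && ~~ [disjoint enum_val i & enum_val j].

Definition adjacency_mx (R : realType) (n : nat) (a : rel 'I_n) : 'M[R]_n :=
  \matrix_(i, j) (a i j)%:R.

Definition M2 (R : realType) (V : finType) (e : rel V) :
    'M[R]_#|edge_set e| :=
  4%:M + adjacency_mx R (@line_graph V e).

Section Optimization.
Variables (R : realType) (m : nat) (M : 'M[R]_m).
Implicit Types (w v : 'cV[R]_m) (i j k : 'I_m).

Definition quad_form w : R := (w^T *m M *m w) 0 0.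

Definition scaled_simplex : set 'cV[R]_m :=
  [set w | ((const_mx 1 : 'cV[R]_m)^T *m w) 0 0 = m%:R /\
           forall k, 0 <= w k 0]%classic.

Definition step_eta w i j : R :=
  Num.min (((M *m w) j 0 - (M *m w) i 0) / 8) (w j 0).

(* Ties in the choices of [i] and [j] may be broken arbitrarily, hence a
   relation rather than a function. *)
Definition step w v : Prop :=
  exists i j,
    [/\ forall k, (M *m w) i 0 <= (M *m w) k 0,
        forall k, step_eta w i k <= step_eta w i j
      & v = w + step_eta w i j *: (delta_mx i 0 - delta_mx j 0)].

End Optimization.

Definition is_minimizer (R : realType) (T : Type) (f : T -> R) (D : set T)
    (x : T) : Prop :=
  D x /\ forall y, D y -> f x <= f y.

(* Main.v *)
Require Import Defs.
From mathcomp Require Import all_boot all_order all_algebra.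
From mathcomp Require Import all_classical all_reals all_analysis.
From mathcomp Require Import ring lra.

(** The argument is an energy estimate.  Write [f] for the quadratic form of
    [M = M2] and [D] for the scaled simplex.  A step moves mass
    [eta] from coordinate [j] to coordinate [i], along a direction of curvature
    at most 8; since the length of the step is capped by the value minimizing
    the corresponding upper bound, [f] drops by at least [8 * eta ^ 2]
    ([step_decrease]).  As [f] is bounded below, the steps [eta] tend to 0.

    The same [eta] controls how far [f] is from its minimum.  By convexity,
    [f w - f u] is at most [2 * <w - u, M w>], and because [w] and [u] have the
    same total mass, the gradient may be shifted by its minimal entry; this
    leaves at most the sum over [k] of [16 * w_k * t_k], with [t_k] as in the
    procedure.  Each product [w_k * t_k] is the product of the smaller and the
    larger factor: the smaller one is [eta_k], at most [eta], and the larger is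
    at most the total mass ([step_gap]).  Hence [(w n)] is a minimizing
    sequence.

    Finally [M = 2 I + N^T N] for the vertex-edge incidence matrix [N]
    ([M2_incidence]), so [f] dominates twice the squared Euclidean norm.
    By the parallelogram identity two almost-minimizers in the convex set [D]
    are then close to each other, so [(w n)] is Cauchy and the minimizer is
    unique; the limit is a minimizer because [f] is continuous and [D] closed
    ([minimizing_sequence_cvg]). *)

Set Implicit Arguments.
Unset Strict Implicit.
Unset Printing Implicit Defensive.

Import Order.TTheory GRing.Theory Num.Theory.
Import numFieldNormedType.Exports.
Local Open Scope classical_set_scope.
Local Open Scope ring_scope.

(** * Minimizing sequences of coercive quadratic forms *)

Section QuadraticForms.
Variables (R : realType) (m : nat) (M : 'M[R]_m).
Implicit Types (u v w d : 'cV[R]_m) (D : set 'cV[R]_m).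

Local Notation f := (quad_form M).

Lemma quad_formZ (a : R) d : f (a *: d) = a ^+ 2 * f d.
Proof.
rewrite /quad_form [(a *: d)^T]linearZ /= -!scalemxAl -scalemxAr scalerA.
by rewrite [LHS]mxE expr2.
Qed.

Lemma quad_formD w d : M^T = M ->
  f (w + d) = f w + 2 * (d^T *m (M *m w)) 0 0 + f d.
Proof.
move=> M_sym.
have cross : (w^T *m M *m d) 0 0 = (d^T *m (M *m w)) 0 0.
  transitivity ((w^T *m M *m d)^T 0 0); first by rewrite [RHS]mxE.
  by rewrite !trmx_mul trmxK M_sym.
have addE (A B : 'M[R]_1) : (A + B) 0 0 = A 0 0 + B 0 0 by rewrite mxE.
rewrite /quad_form [(w + d)^T]linearD /= !mulmxDl !mulmxDr !addE cross !mulmxA.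
by ring.
Qed.

Lemma quad_form_parallelogram u v : M^T = M ->
  f (u - v) = 2 * f u + 2 * f v - 4 * f (2^-1 *: (u + v)).
Proof.
move=> M_sym; rewrite quad_formZ !quad_formD//.
rewrite -[- v]scaleN1r quad_formZ [((-1) *: v)^T]linearZ /= -scalemxAl.
have oppE (A : 'M[R]_1) : (-1 *: A) 0 0 = - A 0 0 by rewrite mxE mulN1r.
rewrite oppE.
by field.
Qed.

Lemma quad_form_continuous : continuous f.
Proof.
have -> : f = fun w => \sum_j (\sum_i w i 0 * M i j) * w j 0.
  apply/funext => v; rewrite /quad_form mxE; apply: eq_bigr => j _.
  by rewrite mxE; congr (_ * _); apply: eq_bigr => i _; rewrite mxE.
have coordC (k : 'I_m) : continuous (fun v : 'cV[R]_m => v k 0).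
  exact: coord_continuous.
apply: continuous_big => [|j _]; first exact: add_continuous.
move=> w; apply: continuousM; last exact: coordC.
move: w; apply: continuous_big => [|i _]; first exact: add_continuous.
by move=> w; apply: continuousM; [exact: coordC | exact: cst_continuous].
Qed.

(** Existence of the minimizer comes from completeness rather than from
    compactness: by the parallelogram identity applied at the midpoint, which
    stays in [D], the distance between two points of [D] is controlled by how
    nearly each of them minimizes [f].  This makes a minimizing sequence Cauchy
    and also yields uniqueness. *)
Lemma minimizing_sequence_cvg (c : R) D (w : nat -> 'cV[R]_m) :
    M^T = M -> 0 < c ->
    (forall d, c * \sum_k d k 0 ^+ 2 <= f d) ->
    closed D -> (forall u v, D u -> D v -> D (2^-1 *: (u + v))) ->
    (forall n, D (w n)) ->
    (forall eps, 0 < eps ->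
       \forall n \near \oo, forall u, D u -> f (w n) - f u <= eps) ->
  exists ws, unique (is_minimizer f D) ws /\ w n @[n --> \oo] --> ws.
Proof.
move=> M_sym c0 coer Dcl Dmid Dw wmin.
(* By the parallelogram identity f (u - v) is twice the sum of the gaps of u
   and v to their midpoint, hence at most half of c * eps ^+ 2: the division
   by 8 leaves room for a strict inequality. *)
have near_min u v eps : D u -> D v -> 0 < eps ->
    (forall z, D z -> f u - f z <= c * eps ^+ 2 / 8) ->
    (forall z, D z -> f v - f z <= c * eps ^+ 2 / 8) ->
    forall k, `|u k 0 - v k 0| < eps.
  move=> Du Dv eps0 umin vmin k.
  have -> : u k 0 - v k 0 = (u - v) k 0 by rewrite !mxE.
  have := umin _ (Dmid _ _ Du Dv); have := vmin _ (Dmid _ _ Du Dv).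
  have := coer (u - v); rewrite quad_form_parallelogram//.
  rewrite (bigD1 k)//= mulrDr.
  have : 0 <= c * \sum_(i < m | i != k) (u - v) i 0 ^+ 2.
    by rewrite mulr_ge0 ?(ltW c0)// sumr_ge0// => i _; exact: sqr_ge0.
  have : 0 < c * eps ^+ 2 by rewrite mulr_gt0// exprn_gt0.
  move=> P1 P2 P3 P4 P5.
  have {P2 P3 P4 P5}: c * (u - v) k 0 ^+ 2 < c * eps ^+ 2 by lra.
  rewrite ltr_pM2l// -[X in X < _]real_normK ?num_real//.
  by rewrite ltr_pXn2r// ?nnegrE// ltW.
have /cvg_ex[ws wsP] : cvg (w n @[n --> \oo]).
  apply: cauchy_cvg; apply: cauchy_exP => eps eps0.
  have : 0 < c * eps ^+ 2 / 8 by rewrite divr_gt0// mulr_gt0// exprn_gt0.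
  move=> /wmin[N _ Nmin]; exists (w N).
  exists N => // n /= Nn; split=> // i j; rewrite (ord1 j).
  by apply: near_min => //; apply: Nmin => /=.
have Dws : D ws by apply: (closed_cvg _ Dcl _ _ wsP); apply: nearW.
have ws_le u : D u -> f ws <= f u.
  move=> Du; apply/ler_addgt0Pl => eps eps0.
  apply: (cvgr_to_le (continuous_cvg _ (@quad_form_continuous ws) wsP)).
  by apply: filterS (wmin _ eps0) => n /(_ u Du); rewrite lerBlDr.
exists ws; split=> //; split=> [|v [Dv v_le]]; first by split.
apply/matrixP => k j; rewrite (ord1 j); apply/eqP.
rewrite -subr_eq0 -normr_le0; apply/ler_addgt0Pl => eps eps0; rewrite addr0.
have e0 : 0 <= c * eps ^+ 2 / 8.
  by rewrite divr_ge0 ?mulr_ge0 ?exprn_ge0// ltW.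
by apply/ltW; apply: near_min => // z Dz; rewrite (le_trans _ e0)// subr_le0;
  [exact: ws_le | exact: v_le].
Qed.

End QuadraticForms.

(** * Descent along pairs of coordinates *)

Section PairwiseDescent.
Variables (R : realType) (m : nat) (M : 'M[R]_m).
Hypotheses (M_sym : M^T = M) (M_bound : forall i j, 0 <= M i j <= 4).
Implicit Types (u v w d : 'cV[R]_m) (i j k : 'I_m).

Local Notation f := (quad_form M).

Lemma scaled_simplexE w :
  scaled_simplex w <-> \sum_k w k 0 = m%:R /\ forall k, 0 <= w k 0.
Proof.
rewrite /scaled_simplex /= mxE.
have -> // : \sum_k (const_mx 1 : 'cV[R]_m)^T 0 k * w k 0 = \sum_k w k 0.
by apply: eq_bigr => k _; rewrite !mxE mul1r.
Qed.

Lemma closed_scaled_simplex : closed (@scaled_simplex R m).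
Proof.
have coordC k : continuous (fun v : 'cV[R]_m => v k 0).
  exact: coord_continuous.
have -> : @scaled_simplex R m =
    (fun w : 'cV[R]_m => \sum_k w k 0) @^-1` [set x | x = m%:R] `&`
    \bigcap_k ((fun w : 'cV[R]_m => w k 0) @^-1` [set x | 0 <= x]).
  apply/seteqP; split=> w.
    by move=> /scaled_simplexE[? w0]; split=> // k _; exact: w0.
  by move=> [? w0]; apply/scaled_simplexE; split=> // k; exact: w0.
apply: closedI.
  apply: closed_comp; last exact: closed_eq.
  move=> w _; move: w; apply: continuous_big => [|i _ //].
  exact: add_continuous.
apply: closed_bigI => k _; apply: closed_comp; last exact: closed_ge.
by move=> w _; exact: coordC.
Qed.

Lemma scaled_simplex_midpoint u v :
  scaled_simplex u -> scaled_simplex v -> scaled_simplex (2^-1 *: (u + v)).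
Proof.
move=> /scaled_simplexE[su u0] /scaled_simplexE[sv v0].
apply/scaled_simplexE; split=> [|k]; last first.
  by rewrite !mxE mulr_ge0 ?invr_ge0 ?addr_ge0.
under eq_bigr do rewrite !mxE.
by rewrite -mulr_sumr big_split /= su sv; field.
Qed.

Lemma scaled_simplex_le w k : scaled_simplex w -> w k 0 <= m%:R.
Proof.
move=> /scaled_simplexE[<- w0].
by rewrite (bigD1 k)//= lerDl sumr_ge0.
Qed.

Lemma gradient_bound w k : scaled_simplex w -> 0 <= (M *m w) k 0 <= 4 * m%:R.
Proof.
move=> /scaled_simplexE[<- w0]; rewrite mxE mulr_sumr; apply/andP; split.
  by apply: sumr_ge0 => i _; rewrite mulr_ge0//; have /andP[] := M_bound k i.
apply: ler_sum => i _; rewrite ler_wpM2r//.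
by have /andP[] := M_bound k i.
Qed.

Lemma mul_delta_diff i j (x : 'cV[R]_m) :
  ((delta_mx i 0 - delta_mx j 0 : 'cV[R]_m)^T *m x) 0 0 = x i 0 - x j 0.
Proof.
rewrite [_^T]linearB /= !trmx_delta mulmxBl -!rowE.
by rewrite !mxE.
Qed.

(** The curvature of [f] along a transfer of mass, for which the denominator 8
    of [step_eta] is tailored: it is [M i i - 2 * M i j + M j j]. *)
Lemma quad_form_delta_diff i j : f (delta_mx i 0 - delta_mx j 0) <= 8.
Proof.
rewrite /quad_form -mulmxA mul_delta_diff mulmxBr -!colE !mxE.
have := M_bound i i; have := M_bound j j.
have := M_bound i j; have := M_bound j i; lra.
Qed.

Lemma step_eta_ge0 w i j : scaled_simplex w ->
  (forall k, (M *m w) i 0 <= (M *m w) k 0) -> 0 <= step_eta M w i j.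
Proof.
move=> /scaled_simplexE[_ w0] imin.
by rewrite /step_eta le_min w0 divr_ge0// subr_ge0.
Qed.

Lemma step_scaled_simplex w v :
  scaled_simplex w -> step M w v -> scaled_simplex v.
Proof.
move=> Dw [i [j [imin jmax ->]]].
have eta0 := step_eta_ge0 j Dw imin.
have eta_le : step_eta M w i j <= w j 0 by rewrite /step_eta ge_min lexx orbT.
move: Dw => /scaled_simplexE[sw w0]; apply/scaled_simplexE; split=> [|k].
  have sum_delta l : \sum_k (delta_mx l 0 : 'cV[R]_m) k 0 = 1.
    rewrite (bigD1 l)//= big1 ?addr0 ?mxE ?eqxx// => k /negPf kl.
    by rewrite mxE kl.
  rewrite (eq_bigr (fun k => w k 0 + step_eta M w i j *
    ((delta_mx i 0 : 'cV[R]_m) k 0 - (delta_mx j 0 : 'cV[R]_m) k 0))); last first.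
    by move=> k _; rewrite !mxE.
  rewrite -[RHS]addr0 big_split /= sw -mulr_sumr big_split /= sumrN !sum_delta.
  by rewrite subrr mulr0.
rewrite !mxE !eqxx !andbT; have := w0 k.
have [->|_] := eqVneq k j; case: (_ == i) => /= ?; lra.
Qed.

(** If [t] is the first argument of the minimum defining the step [eta], then
    expanding [f] and bounding the curvature by 8 gives at most
    [f w - 16 * t * eta + 8 * eta ^ 2] after the step, and [eta <= t]. *)
Lemma step_decrease w i j : scaled_simplex w ->
    (forall k, (M *m w) i 0 <= (M *m w) k 0) ->
  f (w + step_eta M w i j *: (delta_mx i 0 - delta_mx j 0))
    <= f w - 8 * step_eta M w i j ^+ 2.
Proof.
move=> Dw imin; have eta0 := step_eta_ge0 j Dw imin.
have eta_t : step_eta M w i j <= ((M *m w) j 0 - (M *m w) i 0) / 8.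
  by rewrite /step_eta ge_min lexx.
set eta := step_eta M w i j in eta0 eta_t *.
rewrite quad_formD// quad_formZ [(eta *: _)^T]linearZ /= -scalemxAl.
have scaleE (A : 'M[R]_1) : (eta *: A) 0 0 = eta * A 0 0 by rewrite mxE.
rewrite scaleE mul_delta_diff.
have := ler_wpM2l (sqr_ge0 eta) (quad_form_delta_diff i j).
by have := ler_wpM2l eta0 eta_t; lra.
Qed.

(** The largest admissible step certifies near-optimality: it bounds the
    linearized gap, hence by convexity the gap of [f] to any other point. *)
Lemma step_gap w u i eta : (forall d, 0 <= f d) ->
    scaled_simplex w -> scaled_simplex u ->
    (forall k, (M *m w) i 0 <= (M *m w) k 0) ->
    (forall k, step_eta M w i k <= eta) ->
  f w - f u <= 16 * m%:R ^+ 2 * eta.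
Proof.
move=> f_ge0 Dw /scaled_simplexE[su u0] imin eta_max.
have [sw w0] := (scaled_simplexE w).1 Dw.
have gap k : w k 0 * ((M *m w) k 0 - (M *m w) i 0) <= 8 * m%:R * eta.
  have := eta_max k.
  have wkm := scaled_simplex_le k Dw.
  have /andP[_ gk] := gradient_bound k Dw.
  have /andP[gi _] := gradient_bound i Dw.
  have gik := imin k.
  rewrite /step_eta; set t := (_ - _) / 8.
  have -> : (M *m w) k 0 - (M *m w) i 0 = 8 * t by rewrite /t; field.
  have t0 : 0 <= t by rewrite /t; lra.
  have tm : t <= m%:R by rewrite /t; have := ler0n R m; lra.
  (* One of the factors w_k and t is at most eta, the other at most m. *)
  rewrite ge_min => /orP[tle|wle].
    by have := ler_pM (w0 k) t0 wkm tle; lra.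
  by have := ler_pM (w0 k) t0 wle tm; lra.
have := f_ge0 (u - w).
have : f u = f (w + (u - w)) by rewrite subrKC.
rewrite quad_formD// => -> f_d.
suff : - ((u - w)^T *m (M *m w)) 0 0 <= 8 * m%:R ^+ 2 * eta by lra.
rewrite mxE -sumrN.
apply: (@le_trans _ _ (\sum_k w k 0 * ((M *m w) k 0 - (M *m w) i 0))).
  (* Equal masses let the gradient be shifted by the constant (M w)_i. *)
  have sums0 : \sum_k (u k 0 - w k 0) * (M *m w) i 0 = 0.
    by rewrite -mulr_suml big_split /= sumrN su sw subrr mul0r.
  rewrite -[X in X <= _]addr0 -[X in _ + X <= _]sums0 -big_split /=.
  apply: ler_sum => k _; rewrite [_^T 0 k]mxE [(u - w) k 0]mxE [(- w) k 0]mxE.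
  have : 0 <= u k 0 * ((M *m w) k 0 - (M *m w) i 0).
    by rewrite mulr_ge0// subr_ge0.
  lra.
apply: (le_trans (ler_sum _ (fun k _ => gap k))).
by rewrite sumr_const card_ord -mulr_natl; lra.
Qed.

(** The values of [f] decrease to a limit, so the drops, hence by
    [step_decrease] the steps, tend to 0; [step_gap] turns this into
    convergence of [f] to its minimum. *)
Lemma pairwise_descent_cvg (c : R) (w : nat -> 'cV[R]_m) :
    0 < c -> (forall d, c * \sum_k d k 0 ^+ 2 <= f d) ->
    scaled_simplex (w 0%N) -> (forall n, step M (w n) (w n.+1)) ->
  exists ws, unique (is_minimizer f (@scaled_simplex R m)) ws /\
    w n @[n --> \oo] --> ws.
Proof.
move=> c0 coer Dw0 wS.
have f_ge0 d : 0 <= f d.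
  apply: le_trans (coer d); rewrite mulr_ge0 ?(ltW c0)//.
  by rewrite sumr_ge0// => k _; exact: sqr_ge0.
have Dw n : scaled_simplex (w n).
  by elim: n => // n IH; exact: step_scaled_simplex (wS n).
apply: (minimizing_sequence_cvg M_sym c0 coer) => //.
- exact: closed_scaled_simplex.
- exact: scaled_simplex_midpoint.
move=> eps eps0.
have f_cvg : cvg (f (w n) @[n --> \oo]).
  apply: nonincreasing_is_cvgn; last by exists 0 => _ [n _ <-].
  apply/nonincreasing_seqP => n.
  have [i [j [imin _ ->]]] := wS n.
  apply: le_trans (step_decrease j (Dw n) imin) _.
  by rewrite gerBl mulr_ge0// sqr_ge0.
have drop_cvg : f (w n) - f (w n.+1) @[n --> \oo] --> 0.
  rewrite -[X in _ --> X](subrr (lim (f (w n) @[n --> \oo]))).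
  apply: cvgB => //.
  by have := f_cvg; rewrite -(cvg_shiftS (fun n => f (w n))).
(* The summand 1 only serves to make K nonzero. *)
pose K : R := 16 * m%:R ^+ 2 + 1.
have K0 : 0 < K by rewrite /K ltr_wpDl// mulr_ge0// sqr_ge0.
have tol0 : 0 < 8 * (eps / K) ^+ 2 by rewrite mulr_gt0// exprn_gt0// divr_gt0.
have drop_near := cvgr0_norm_lt _ drop_cvg _ tol0.
near=> n => u Du.
have drop_lt : `|f (w n) - f (w n.+1)| < 8 * (eps / K) ^+ 2.
  by near: n; exact: drop_near.
have [i [j [imin jmax wSn]]] := wS n.
have := step_decrease j (Dw n) imin; rewrite -wSn => drop_ge.
have eta0 := step_eta_ge0 j (Dw n) imin.
apply: (le_trans (step_gap f_ge0 (Dw n) Du imin jmax)).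
set eta := step_eta _ _ _ _ in eta0 drop_ge *.
have : 8 * eta ^+ 2 < 8 * (eps / K) ^+ 2.
  by apply: le_lt_trans drop_lt; rewrite (le_trans _ (ler_norm _))//; lra.
rewrite ltr_pM2l// ltr_pXn2r ?nnegrE ?(ltW (divr_gt0 eps0 K0))//.
rewrite ltr_pdivlMr// => eta_lt.
apply: ltW; apply: le_lt_trans eta_lt.
by rewrite mulrC ler_wpM2l// /K lerDl.
Unshelve. all: by end_near. Qed.

End PairwiseDescent.

(** * The matrix of a line graph *)

Section LineGraph.
Variables (R : realType) (V : finType) (e : rel V).
Hypothesis e_irr : irreflexive e.

Lemma card_edge (A : {set V}) : A \in edge_set e -> #|A| = 2.
Proof.
rewrite inE => /existsP[x /existsP[y /andP[exy /eqP->]]].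
by rewrite cards2; case: eqVneq exy => // ->; rewrite e_irr.
Qed.

(** Two distinct edges of a simple graph share at most one vertex. *)
Lemma card_edgeI (A B : {set V}) :
  A \in edge_set e -> B \in edge_set e -> A != B ->
  #|A :&: B|%SET = ~~ [disjoint A & B].
Proof.
move=> /card_edge cA /card_edge cB AB.
have : (#|A :&: B|%SET < 2)%N.
  rewrite ltnNge; apply: contra AB => cI.
  have AI : (A :&: B)%SET = A by apply/eqP; rewrite eqEcard finset.subsetIl cA.
  by rewrite eqEcard cA cB leqnn andbT; apply/finset.setIidPl.
by rewrite -setI_eq0 -cards_eq0; case: #|_| => [|[]].
Qed.

Definition incidence_mx : 'M[R]_(#|V|, #|edge_set e|) :=
  \matrix_(x, k) (enum_val x \in (enum_val k : {set V}))%:R.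

(** Off the diagonal [N^T N] counts common endpoints, which is 0 or 1 by
    [card_edgeI]; on the diagonal it is 2, the number of ends of an edge.  This
    is the source of positive definiteness. *)
Lemma M2_incidence : M2 R e = 2%:M + incidence_mx^T *m incidence_mx.
Proof.
apply/matrixP => i j; rewrite !mxE.
have -> : \sum_x incidence_mx^T i x * incidence_mx x j =
    #|enum_val i :&: enum_val j|%SET%:R.
  under eq_bigr do rewrite !mxE -natrM mulnb -finset.in_setI.
  rewrite -(big_enum_val (fun x => (x \in _ :&: _)%SET%:R)) /=.
  by rewrite -natr_sum -sum1_card [in RHS]big_mkcond.
rewrite /line_graph; have [<-|ij] /= := eqVneq i j.
  by rewrite finset.setIid card_edge ?enum_valP// !mulr1n addr0 -natrD.
by rewrite card_edgeI ?enum_valP ?(inj_eq enum_val_inj)// !mulr0n.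
Qed.

Lemma M2_sym : (M2 R e)^T = M2 R e.
Proof.
by rewrite M2_incidence linearD /= tr_scalar_mx trmx_mul trmxK.
Qed.

Lemma M2_bound i j : 0 <= M2 R e i j <= 4.
Proof.
rewrite !mxE /line_graph; have [<-|ij] /= := eqVneq i j.
  by rewrite mulr1n addr0 lexx ler0n.
by rewrite mulr0n add0r ler0n -[4]/(4%:R) ler_nat (leq_trans (leq_b1 _)).
Qed.

Lemma M2_coercive (d : 'cV[R]_#|edge_set e|) :
  2 * \sum_k d k 0 ^+ 2 <= quad_form (M2 R e) d.
Proof.
have sumsq p (x : 'cV[R]_p) : (x^T *m x) 0 0 = \sum_k x k 0 ^+ 2.
  by rewrite mxE; apply: eq_bigr => k _; rewrite mxE expr2.
rewrite /quad_form M2_incidence mulmxDr mulmxDl mul_mx_scalar -scalemxAl.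
rewrite [leRHS]mxE [X in _ <= X + _]mxE sumsq lerDl.
rewrite mulmxA -mulmxA -trmx_mul sumsq.
by apply: sumr_ge0 => k _; exact: sqr_ge0.
Qed.

End LineGraph.

Theorem theorem4p23 (R : realType) (V : finType) (e : rel V)
    (e_sym : symmetric e) (e_irr : irreflexive e)
    (m_ge1 : (1 <= #|edge_set e|)%N)
    (w : nat -> 'cV[R]_#|edge_set e|)
    (w0 : w 0%N = const_mx 1)
    (wS : forall n : nat, step (M2 R e) (w n) (w n.+1)) :
  exists ws : 'cV[R]_#|edge_set e|,
    unique (is_minimizer (quad_form (M2 R e))
                         (@scaled_simplex R #|edge_set e|)) ws /\
    w n @[n --> \oo] --> ws.
Proof.
apply: (pairwise_descent_cvg (M2_sym R e_irr) (@M2_bound R V e)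
  _ (M2_coercive e_irr) _ wS) => //.
rewrite w0; apply/scaled_simplexE; split=> [|k]; last by rewrite mxE.
by under eq_bigr do rewrite mxE; rewrite sumr_const card_ord.
Qed.
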